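(* Let $s=2$ and $$A=\begin{pmatrix}1&0\\0&\tfrac12\end{pmatrix},\qquad \boldsymbol b=\begin{pmatrix}\tfrac12\\ \tfrac12\end{pmatrix},\qquad \boldsymbol c=\begin{pmatrix}1\\ \tfrac12\end{pmatrix},\qquad D=\begin{pmatrix}1&0\\-1&2\end{pmatrix}.$$ Then the product-type IMEX-RK projection scheme described in the context with these coefficients is second-order, i.e. $$\boldsymbol b^\top\boldsymbol 1=1,\qquad \boldsymbol b^\top J\boldsymbol c=\boldsymbol b^\top D\boldsymbol c=\tfrac12,$$ and, for every time step $\tau>0$, it preserves the unit length $|\boldsymbol m^{n+1}|=1$ and dissipates the Dirichlet energy: $$\int_\Omega \tfrac12\big|\nabla\boldsymbol m^{n+1}\big|^2\,\mathrm d\boldsymbol x\leqslant\int_\Omega\tfrac12\big|\nabla\boldsymbol m^{n}\big|^2\,\mathrm d\boldsymbol x .$$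
   Context: The continuous problem is the gradient flow of the Dirichlet energy $E[\boldsymbol m]=\int_\Omega\frac12|\nabla\boldsymbol m|^2\,\mathrm d\boldsymbol x$ for $\boldsymbol m:\Omega\to\mathbb R^3$ with unit length $|\boldsymbol m|=1$: $$\boldsymbol m_t=P(\boldsymbol m)\Delta\boldsymbol m,\qquad P(\boldsymbol m)\boldsymbol v=\alpha\Big(\boldsymbol v-\frac{(\boldsymbol m\cdot\boldsymbol v)\boldsymbol m}{|\boldsymbol m|^2}\Big)+\beta\,\boldsymbol m\times\boldsymbol v,$$ with constants $\alpha>0$, $\beta\in\mathbb R$, initial data of unit length, and either time-independent Dirichlet boundary conditions or homogeneous Neumann boundary conditions on $\partial\Omega$ ($\Omega$ a bounded domain with sufficiently regular boundary). Notation: $A=(a_{ij})$, $D=(d_{ij})$, $\boldsymbol b=(b_j)$, $\boldsymbol c=A\boldsymbol 1$, $\boldsymbol 1=(1,1)^\top$, and $J=\begin{pmatrix}0&0\\1&0\end{pmatrix}$. Scheme (discrete in time, continuous in space): given $\boldsymbol m^n$ with $|\boldsymbol m^n|=1$, set $\boldsymbol u_0=\boldsymbol m^n$ and $$\boldsymbol u_i=\boldsymbol u_0+\tau\sum_{j=1}^i a_{ij}P(\boldsymbol u_{j-1})\sum_{k=1}^j d_{jk}\Delta\boldsymbol u_k,\quad i=1,2,$$ $$\tilde{\boldsymbol m}^{n+1}=\boldsymbol u_0+\tau\sum_{j=1}^2 b_jP(\boldsymbol u_{j-1})\sum_{k=1}^j d_{jk}\Delta\boldsymbol u_k,\qquad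 \boldsymbol m^{n+1}=\frac{\tilde{\boldsymbol m}^{n+1}}{|\tilde{\boldsymbol m}^{n+1}|},$$ where every $\boldsymbol u_i$ satisfies the boundary conditions of the problem (the same Dirichlet data as $\boldsymbol m^n$, or homogeneous Neumann). The stages $\boldsymbol u_i$ are assumed to exist and to be regular enough for integration by parts. ''Second-order'' means that the coefficients satisfy the first- and second-order conditions of product-type IMEX-RK schemes, which for this scheme (explicit inner matrix equal to the identity, implicit inner matrix $D$) are the displayed identities. *)

(* Defs.v *)
From HB Require Import structures.
From mathcomp Require Import all_boot all_order all_algebra.
From mathcomp Require Import all_classical all_reals all_analysis.
From mathcomp Require Import measurable_realfun.

Set Implicit Arguments.
Unset Strict Implicit.
Unset Printing Implicit Defensive.

Import Order.TTheory GRing.Theory Num.Theory.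
Import numFieldNormedType.Exports.

Local Open Scope classical_set_scope.
Local Open Scope ring_scope.

Section borel.
Variable R : realType.

Definition matrix_borel_display : measure_display. Proof. exact. Qed.

Section instance.
Variables m n : nat.

Let s0 : <<s @open 'M[R]_(m, n) >> set0.
Proof. exact: sigma_algebra0. Qed.

Let sC A : <<s @open 'M[R]_(m, n) >> A -> <<s @open 'M[R]_(m, n) >> (~` A).
Proof. exact: sigma_algebraC. Qed.

Let sU (F : (set 'M[R]_(m, n))^nat) : (forall i, <<s open >> (F i)) ->
  <<s @open 'M[R]_(m, n) >> (\bigcup_i F i).
Proof. exact: sigma_algebra_bigcup. Qed.

HB.instance Definition _ := @isMeasurable.Build matrix_borel_display
  'M[R]_(m, n) <<s open >> s0 sC sU.

End instance.

Lemma open_measurable_mx m n (A : set 'M[R]_(m, n)) : open A -> measurable A.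
Proof. exact: sub_sigma_algebra. Qed.

Definition consr n (p : R * 'rV[R]_n) : 'rV[R]_n.+1 := row_mx p.1%:M p.2.

Definition unconsr n (x : 'rV[R]_n.+1) : R * 'rV[R]_n :=
  (x 0 0, \row_j x 0 (lift ord0 j)).

Lemma unconsrK n : cancel (@unconsr n) (@consr n).
Proof.
move=> x; apply/rowP => i; rewrite /consr /unconsr /=.
rewrite /row_mx; move: (@splitP 1 n i) => H.
rewrite mxE /=; case: (@splitP 1 n i) => j ij; rewrite !mxE.
  rewrite !ord1 eqxx mulr1n; congr (x 0 _).
  by apply/val_inj; rewrite /= ij ord1.
by congr (x 0 _); apply/val_inj; rewrite /= ij.
Qed.

Lemma consrK n : cancel (@consr n) (@unconsr n).
Proof.
move=> [t x]; rewrite /consr /unconsr /=; congr pair.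
  rewrite mxE; case: (@splitP 1 n _) => j //= _.
  by rewrite !mxE !ord1 eqxx mulr1n.
apply/rowP => j; rewrite !mxE; case: (@splitP 1 n _) => k /=.
  by rewrite ord1 /bump /=.
by rewrite /bump /= !add1n => -[] jk; congr (x 0 _); apply/val_inj.
Qed.

Lemma consr0 n (p : R * 'rV[R]_n) : consr p 0 0 = p.1.
Proof. by have := consrK p => /(congr1 fst). Qed.

Lemma consrS n (p : R * 'rV[R]_n) j : consr p 0 (lift ord0 j) = p.2 0 j.
Proof. by have := consrK p => /(congr1 snd) /rowP /(_ j); rewrite mxE. Qed.

Lemma measurable_consr n : measurable_fun [set: R * 'rV[R]_n] (@consr n).
Proof.
apply: (@measurability _ _ _ _ _ _ (@open 'rV[R]_n.+1)) => //.
move=> _ [U oU <-]; rewrite setTI.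
pose q0 (q : 'rV[rat]_n.+1) : 'rV[R]_n.+1 := map_mx ratr q.
pose I := [set i : 'rV[rat]_n.+1 * nat |
  ball (q0 i.1) i.2.+1%:R^-1 `<=` U].
have -> : @consr n @^-1` U = \bigcup_(i in I)
    (ball (q0 i.1 0 0) i.2.+1%:R^-1 `*`
     ball (\row_j q0 i.1 0 (lift ord0 j)) i.2.+1%:R^-1).
  apply/seteqP; split => [p /= Up|p [[q k] /= qkU [pq0 pq1]]].
    have := oU; rewrite openE => /(_ _ Up) /nbhs_ballP[e /= e0 eU].
    have [k _ ke] := near_infty_natSinv_lt (PosNum (divr_gt0 e0 (ltr0Sn R 1))).
    have {}ke := ke k (leqnn k); rewrite /= in ke.
    have k0 : 0 < k.+1%:R^-1 :> R by rewrite invr_gt0.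
    have /choice[f fP] : forall j : 'I_n.+1, exists q : rat,
        ball (ratr q : R) k.+1%:R^-1 (consr p 0 j).
      move=> j; have [q] := @rat_in_itvoo R (consr p 0 j - k.+1%:R^-1)
        (consr p 0 j + k.+1%:R^-1) ltac:(by rewrite ltrBlDr -addrA ltrDl addr_gt0).
      rewrite in_itv /= => /andP[q1 q2]; exists q.
      by rewrite /ball /= ltr_distl q1 q2.
    exists (\row_j f j, k) => /=.
      move=> y /= [_ yq]; apply: eU; split=> // i j.
      have h1 := yq i j; rewrite !mxE in h1; rewrite (ord1 i).
      have h2 := ball_sym (fP j).
      apply: (@le_ball _ _ _ (k.+1%:R^-1 + k.+1%:R^-1)).
        by rewrite (splitr e) lerD// ltW.
      by apply: ball_triangle h2 _; rewrite -(ord1 i).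
    split => /=; first by have := fP 0; rewrite consr0 !mxE.
    by split=> // i j; have := fP (lift ord0 j); rewrite consrS !mxE !ord1.
  case: pq1 => k0 pq1; apply: qkU; split=> // i j; rewrite (ord1 i).
  case: (unliftP ord0 j) => [j' ->|->]; last by rewrite consr0.
  by have := pq1 0 j'; rewrite consrS mxE.
rewrite bigcup_mkcond; apply: countable_bigcupT_measurable => // -[q k].
case: ifPn => // _; apply: measurableX.
  by apply: open_measurable; exact: ball_open.
by apply: open_measurable_mx; exact: ball_open.
Qed.

Lemma measurable_coord n (i : 'I_n) :
  measurable_fun [set: 'rV[R]_n] (fun x : 'rV[R]_n => x 0 i).
Proof.
apply: (measurability _ (RGenOpens.measurableE R)).
move=> _ [_ [a [b ->] <-]]; rewrite setTI; apply: open_measurable_mx.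
by apply: open_comp (interval_open _ _) => // x _; exact: coord_continuous.
Qed.

Lemma measurable_unconsr n : measurable_fun [set: 'rV[R]_n.+1] (@unconsr n).
Proof.
apply: measurable_fun_pair; first exact: measurable_coord.
apply: (@measurability _ _ _ _ _ _ (@open 'rV[R]_n)) => //.
move=> _ [U oU <-]; rewrite setTI; apply: open_measurable_mx.
apply: open_comp oU => x _.
have -> : (fun y : 'rV[R]_n.+1 => \row_j y 0 (lift ord0 j)) =
    (rsubmx : 'rV[R]_(1 + n) -> 'rV[R]_n).
  apply/funext => y; apply/rowP => j; rewrite !mxE; congr (y 0 _).
  exact/val_inj.
exact: continuous_rsubmx.
Qed.

Section step.
Variables (n : nat) (mu : {sigma_finite_measure set 'rV[R]_n -> \bar R}).

Definition lebesgue_step : set 'rV[R]_n.+1 -> \bar R :=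
  pushforward (@lebesgue_measure R \x mu)%E (@consr n).

Let step_measurable A : measurable A -> measurable (@consr n @^-1` A).
Proof. by move=> mA; rewrite -[X in measurable X]setTI; exact: measurable_consr. Qed.

Let step0 : lebesgue_step set0 = 0%E.
Proof. by rewrite /lebesgue_step /pushforward preimage_set0 measure0. Qed.

Let step_ge0 A : (0 <= lebesgue_step A)%E.
Proof. exact: (measure_ge0 (@lebesgue_measure R \x mu)%E). Qed.

Let step_sigma_additive : semi_sigma_additive lebesgue_step.
Proof.
move=> F mF tF mU; rewrite /lebesgue_step /pushforward preimage_bigcup.
apply: measure_semi_sigma_additive.
- by move=> k; exact: step_measurable.
- apply/trivIsetP => /= i j _ _ ij; rewrite -preimage_setI.
  by move/trivIsetP : tF => /(_ _ _ _ _ ij) ->//; rewrite preimage_set0.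
- by rewrite -preimage_bigcup; exact: step_measurable.
Qed.

HB.instance Definition _ := isMeasure.Build _ _ _
  lebesgue_step step0 step_ge0 step_sigma_additive.

Let step_sigma_finite : sigma_finite setT lebesgue_step.
Proof.
have [F FT Foo] : sigma_finite setT (@lebesgue_measure R \x mu)%E.
  have /sigma_finiteP[F [TF ndF Foo]] := sigma_finiteT (@lebesgue_measure R).
  have /sigma_finiteP[G [TG ndG Goo]] := sigma_finiteT mu.
  exists (fun k => F k `*` G k) => [|k].
    rewrite -setXTT TF TG predeqE => -[x y]; split=> [/= [[i _ Fx] [j _ Gy]]|].
      exists (maxn i j) => //; split.
        by move: x Fx; exact/subsetPset/ndF/leq_maxl.
      by move: y Gy; exact/subsetPset/ndG/leq_maxr.
    by move=> [i _ [/= Fx Gy]]; split; exists i.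
  have [mF Fk] := Foo k; have [mG Gk] := Goo k.
  split; first exact: measurableX.
  by rewrite product_measure1E// lte_mul_pinfty// ge0_fin_numE.
exists (fun k => @unconsr n @^-1` F k) => [|k].
  by rewrite -preimage_bigcup -FT preimage_setT.
have [mF Fk] := Foo k; split.
  by rewrite -[X in measurable X]setTI; exact: measurable_unconsr.
rewrite /lebesgue_step /pushforward (_ : _ @^-1` _ = F k)//.
by apply/seteqP; split => p; rewrite /preimage/= consrK.
Qed.

HB.instance Definition _ := Measure_isSigmaFinite.Build _ _ _
  lebesgue_step step_sigma_finite.

End step.

(* Lebesgue measure on R^n, as the product of R and R^(n-1). *)
Fixpoint lebesgue_rV n : {sigma_finite_measure set 'rV[R]_n -> \bar R} :=
  if n is n'.+1 then lebesgue_step (lebesgue_rV n') else \d_(0 : 'rV[R]_0).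

Lemma lebesgue_rVS n A :
  lebesgue_rV n.+1 A = (lebesgue_measure \x lebesgue_rV n)%E (@consr n @^-1` A).
Proof. by []. Qed.

(* The value on boxes characterizes Lebesgue measure. *)
Lemma lebesgue_rV_box n (a b : 'rV[R]_n) : (forall i, a 0 i <= b 0 i) ->
  lebesgue_rV n [set x | forall i, a 0 i < x 0 i <= b 0 i] =
    (\prod_i (b 0 i - a 0 i))%:E.
Proof.
elim: n => [|n IH] in a b * => ab.
  rewrite big_ord0 /= diracE mem_set//.
  by case.
rewrite lebesgue_rVS big_ord_recl.
pose a' : 'rV[R]_n := \row_j a 0 (lift ord0 j).
pose b' : 'rV[R]_n := \row_j b 0 (lift ord0 j).
have -> : @consr n @^-1` [set x | forall i, a 0 i < x 0 i <= b 0 i] =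
  `]a 0 0, b 0 0]%classic `*` [set x : 'rV[R]_n | forall i, a' 0 i < x 0 i <= b' 0 i].
  apply/seteqP; split => [p /= pab|p [/= p0 pj] i].
    split => /=; first by have := pab 0; rewrite consr0 in_itv.
    by move=> i; have := pab (lift ord0 i); rewrite consrS !mxE.
  case: (unliftP ord0 i) => [j ->|->]; last by rewrite consr0; move: p0; rewrite in_itv.
  by rewrite consrS; have := pj j; rewrite !mxE.
rewrite product_measure1E//=; last first.
  rewrite (_ : [set _ | _] = \bigcap_(i in [set: 'I_n])
      ((fun x : 'rV[R]_n => x 0 i) @^-1` `]a' 0 i, b' 0 i]%classic)).
    apply: fin_bigcap_measurable => // i _.
    by rewrite -[X in measurable X]setTI; exact: measurable_coord.
  apply/seteqP; split => x /= xab i; first by rewrite /= in_itv/= => _; exact: xab.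
  by have := xab i I; rewrite /= in_itv.
rewrite lebesgue_measure_itv /= lte_fin IH; last by move=> i; rewrite !mxE.
rewrite EFinM; congr (_ * _)%E; last by congr EFin; apply: eq_bigr => i _; rewrite !mxE.
case: ltP => // ba.
by rewrite (_ : a 0 0 = b 0 0) ?subrr//; apply/le_anti; rewrite ab ba.
Qed.

End borel.

Arguments lebesgue_rV {R} n.

Section calculus.
Variable R : realType.

(* The norm `|v| of 'rV[R]_n in the library is the sup norm. *)
Definition dot n (v w : 'rV[R]_n) : R := \sum_i v 0 i * w 0 i.

Definition enorm n (v : 'rV[R]_n) : R := Num.sqrt (dot v v).

(* Indices are added modulo 3, in the ring 'I_3. *)
Definition cross (v w : 'rV[R]_3) : 'rV[R]_3 :=
  \row_(i < 3) (v 0 (i + 1) * w 0 (i + 2) - v 0 (i + 2) * w 0 (i + 1)).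

Definition basis_vec d (j : 'I_d) : 'rV[R]_d := delta_mx 0 j.

Definition partial d k (j : 'I_d) (f : 'rV[R]_d -> 'rV[R]_k) :
  'rV[R]_d -> 'rV[R]_k := 'D_(basis_vec j) f.

Definition laplacian d k (f : 'rV[R]_d -> 'rV[R]_k) (x : 'rV[R]_d) : 'rV[R]_k :=
  \sum_(j < d) partial j (partial j f) x.

Definition divergence d (F : 'rV[R]_d -> 'rV[R]_d) (x : 'rV[R]_d) : R :=
  \sum_(j < d) partial j F x 0 j.

(* |grad f|^2, the squared Frobenius norm of the Jacobian. *)
Definition grad_sqr d k (f : 'rV[R]_d -> 'rV[R]_k) (x : 'rV[R]_d) : R :=
  \sum_(j < d) enorm (partial j f x) ^+ 2.

Definition dirichlet_energy d (Omega : set 'rV[R]_d)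
    (m : 'rV[R]_d -> 'rV[R]_3) : \bar R :=
  (\int[lebesgue_rV d]_(x in Omega) (2^-1 * grad_sqr m x)%:E)%E.

Definition C1 d k (Omega : set 'rV[R]_d) (f : 'rV[R]_d -> 'rV[R]_k) : Prop :=
  forall x, Omega x -> differentiable f x /\
    forall j : 'I_d, {for x, continuous (partial j f)}.

Definition C2 d k (Omega : set 'rV[R]_d) (f : 'rV[R]_d -> 'rV[R]_k) : Prop :=
  C1 Omega f /\ forall j : 'I_d, C1 Omega (partial j f).

(* C^1 up to the boundary: the first derivatives, which make sense in the open
   set Omega only, extend continuously to the closure. *)
Definition C1_closure d k (Omega : set 'rV[R]_d)
    (f : 'rV[R]_d -> 'rV[R]_k) : Prop :=
  [/\ {within closure Omega, continuous f}, C1 Omega f &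
    forall j : 'I_d, exists g : 'rV[R]_d -> 'rV[R]_k,
      {within closure Omega, continuous g} /\
      forall x, Omega x -> g x = partial j f x].

Definition boundary d (Omega : set 'rV[R]_d) : set 'rV[R]_d :=
  closure Omega `\` interior Omega.

(* A bounded domain on which the divergence theorem holds, with surface measure
   sigma and outward unit normal nu, for every continuous field on the closure
   that is C^1 inside with integrable divergence. All bounded Lipschitz domains
   are of this kind (nu may be chosen arbitrarily on the sigma-null set of
   boundary points without a normal). Conversely, the identity leaves no
   freedom in sigma and nu: the vector measure nu sigma on the boundary is
   minus the distributional gradient of the indicator function of Omega, and
   |nu| = 1. *)
Record regular_domain d (Omega : set 'rV[R]_d)
    (sigma : {finite_measure set 'rV[R]_d -> \bar R})
    (nu : 'rV[R]_d -> 'rV[R]_d) : Prop := RegularDomain {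
  domain_open : open Omega ;
  domain_connected : connected Omega ;
  domain_nonempty : Omega !=set0 ;
  domain_bounded : bounded_set Omega ;
  normal_measurable : measurable_fun (boundary Omega) nu ;
  normal_unit : forall x, boundary Omega x -> enorm (nu x) = 1 ;
  divergence_theorem : forall F : 'rV[R]_d -> 'rV[R]_d,
    {within closure Omega, continuous F} -> C1 Omega F ->
    (lebesgue_rV d).-integrable Omega (fun x => (divergence F x)%:E) ->
    (\int[lebesgue_rV d]_(x in Omega) (divergence F x)%:E =
     \int[sigma]_(x in boundary Omega) (dot (F x) (nu x))%:E)%E
}.

Inductive boundary_condition d :=
  | Dirichlet of ('rV[R]_d -> 'rV[R]_3)
  | Neumann.

(* The normal derivative at a boundary point x is the limit of the derivative
   in the fixed direction nu x as the point tends to x inside Omega. *)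
Definition satisfies_bc d (Omega : set 'rV[R]_d)
    (sigma : {finite_measure set 'rV[R]_d -> \bar R})
    (nu : 'rV[R]_d -> 'rV[R]_d) (bc : boundary_condition d)
    (u : 'rV[R]_d -> 'rV[R]_3) : Prop :=
  match bc with
  | Dirichlet g => forall x, boundary Omega x -> u x = g x
  | Neumann => {ae sigma, forall x, boundary Omega x ->
      'D_(nu x) u @ within Omega (nbhs x) --> (0 : 'rV[R]_3)}
  end.

Definition Pop (alpha beta : R) (m v : 'rV[R]_3) : 'rV[R]_3 :=
  alpha *: (v - (dot m v / enorm m ^+ 2) *: m) + beta *: cross m v.

(* Matrix indices start at 0 while stages start at u_0, so index j : 'I_s
   stands for j + 1: this is P(u_j) sum_(1 <= k <= j+1) d_(j+1)k Delta u_k. *)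
Definition imex_slope d s (alpha beta : R) (D : 'M[R]_s)
    (u : nat -> 'rV[R]_d -> 'rV[R]_3) (j : 'I_s) (x : 'rV[R]_d) : 'rV[R]_3 :=
  Pop alpha beta (u j x)
    (\sum_(k < s | (k <= j)%N) D j k *: laplacian (u k.+1) x).

(* Only u 0, ..., u s are meaningful. *)
Definition imex_stages d s (alpha beta tau : R) (A D : 'M[R]_s)
    (Omega : set 'rV[R]_d) (mn : 'rV[R]_d -> 'rV[R]_3)
    (u : nat -> 'rV[R]_d -> 'rV[R]_3) : Prop :=
  u 0%N = mn /\
  forall (i : 'I_s) (x : 'rV[R]_d), Omega x ->
    u i.+1 x = u 0%N x + tau *:
      \sum_(j < s | (j <= i)%N) A i j *: imex_slope alpha beta D u j x.

Definition imex_update d s (alpha beta tau : R) (b : 'cV[R]_s) (D : 'M[R]_s)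
    (u : nat -> 'rV[R]_d -> 'rV[R]_3) (x : 'rV[R]_d) : 'rV[R]_3 :=
  u 0%N x + tau *: \sum_(j < s) b j 0 *: imex_slope alpha beta D u j x.

Definition imex_next d s (alpha beta tau : R) (b : 'cV[R]_s) (D : 'M[R]_s)
    (u : nat -> 'rV[R]_d -> 'rV[R]_3) (x : 'rV[R]_d) : 'rV[R]_3 :=
  (enorm (imex_update alpha beta tau b D u x))^-1 *:
    imex_update alpha beta tau b D u x.

(* The assumed regularity of the stages: the hypotheses under which Green's
   first identity follows from the divergence theorem. *)
Definition stage_regular d (Omega : set 'rV[R]_d)
    (u : 'rV[R]_d -> 'rV[R]_3) : Prop :=
  [/\ C1_closure Omega u, C2 Omega u &
    forall i : 'I_3, (lebesgue_rV d).-integrable Omega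
      (fun x => (laplacian u x 0 i)%:E)].

Definition mx22 (a b c d : R) : 'M[R]_2 :=
  \matrix_(i, j) (if i == 0 then if j == 0 then a else b
                  else if j == 0 then c else d).

Definition cv2 (a b : R) : 'cV[R]_2 := \col_i (if i == 0 then a else b).

Definition onev : 'cV[R]_2 := const_mx 1.

Definition Jmx : 'M[R]_2 := mx22 0 0 1 0.

(* First- and second-order conditions; the entry 0 0 is the only one of these
   products. *)
Definition second_order (A D : 'M[R]_2) (b : 'cV[R]_2) : Prop :=
  let c := A *m onev in
  [/\ (b^T *m onev) 0 0 = 1, (b^T *m Jmx *m c) 0 0 = 2^-1 &
      (b^T *m D *m c) 0 0 = 2^-1].

Definition A2 : 'M[R]_2 := mx22 1 0 0 2^-1.
Definition b2 : 'cV[R]_2 := cv2 2^-1 2^-1.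
Definition c2 : 'cV[R]_2 := cv2 1 2^-1.
Definition D2 : 'M[R]_2 := mx22 1 0 (- 1) 2.

End calculus.

Arguments Neumann {R d}.
Arguments A2 {R}.
Arguments b2 {R}.
Arguments c2 {R}.
Arguments D2 {R}.
Arguments onev {R}.

(* Main.v *)
(** Let [x = u_1 - u_0] and [y = u_2 - u_0]; the tableau gives the unnormalized
    update [u_0 + x/2 + y]. Since [P(m)v] is orthogonal to [m], [x] is orthogonal
    to [u_0] and [y] to [u_1], hence [|u_0 + x/2 + y|^2 = 1 + |x/2 - y|^2 >= 1]
    and the normalization does not increase the gradient pointwise. For the
    gradients, with [a = grad u_0],
      [|a + x/2 + y|^2 = |a|^2 + (a + x).x + 2 (a + 2y - x).y - 3 |x/2 - y|^2],
    where [a + x = grad u_1] and [a + 2y - x = grad (2 u_2 - u_1)]. Green's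
    identity turns the two middle terms into
    [- tau <Delta u_1, P(u_0) Delta u_1>] and
    [- tau <Delta v, P(u_1) Delta v>], [v = 2 u_2 - u_1], both nonpositive; its
    boundary terms vanish because [x] and [y] do (Dirichlet) or because the
    normal derivatives do (Neumann). *)
Require Import Defs.
From mathcomp Require Import all_boot all_order all_algebra.
From mathcomp Require Import all_classical all_reals all_analysis.
From mathcomp Require Import measurable_realfun ring lra.

Import Order.TTheory GRing.Theory Num.Theory.
Import numFieldNormedType.Exports.

Local Open Scope classical_set_scope.
Local Open Scope ring_scope.

Set Implicit Arguments.
Unset Strict Implicit.
Unset Printing Implicit Defensive.

(** * Euclidean inner product and the pointwise properties of [Pop] *)

Section dot_product.
Context {R : realType}.

Lemma dotC n (v w : 'rV[R]_n) : dot v w = dot w v.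
Proof. by apply: eq_bigr => i _; rewrite mulrC. Qed.

Lemma dotDl n (u v w : 'rV[R]_n) : dot (u + v) w = dot u w + dot v w.
Proof. by rewrite /dot -big_split; apply: eq_bigr => i _; rewrite mxE mulrDl. Qed.

Lemma dotZl n k (v w : 'rV[R]_n) : dot (k *: v) w = k * dot v w.
Proof. by rewrite /dot mulr_sumr; apply: eq_bigr => i _; rewrite mxE mulrA. Qed.

Lemma dotNl n (v w : 'rV[R]_n) : dot (- v) w = - dot v w.
Proof. by rewrite -scaleN1r dotZl mulN1r. Qed.

Lemma dotDr n (u v w : 'rV[R]_n) : dot u (v + w) = dot u v + dot u w.
Proof. by rewrite dotC dotDl !(dotC u). Qed.

Lemma dotZr n k (v w : 'rV[R]_n) : dot v (k *: w) = k * dot v w.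
Proof. by rewrite dotC dotZl dotC. Qed.

Lemma dotNr n (v w : 'rV[R]_n) : dot v (- w) = - dot v w.
Proof. by rewrite dotC dotNl dotC. Qed.

Definition dotE := (dotDl, dotDr, dotZl, dotZr, dotNl, dotNr).

Lemma dot0r n (v : 'rV[R]_n) : dot v 0 = 0.
Proof. by rewrite -(scale0r 0) dotZr mul0r. Qed.

Lemma dot0l n (v : 'rV[R]_n) : dot 0 v = 0.
Proof. by rewrite dotC dot0r. Qed.

Lemma dot_suml n I (r : seq I) (F : I -> 'rV[R]_n) v :
  dot (\sum_(i <- r) F i) v = \sum_(i <- r) dot (F i) v.
Proof.
by elim/big_rec2 : _ => [|i x y _ <-]; rewrite ?dot0l ?dotDl.
Qed.

Lemma dot_ge0 n (v : 'rV[R]_n) : 0 <= dot v v.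
Proof. by apply: sumr_ge0 => i _; rewrite -expr2 sqr_ge0. Qed.

Lemma enorm_sqr n (v : 'rV[R]_n) : enorm v ^+ 2 = dot v v.
Proof. by rewrite /enorm sqr_sqrtr ?dot_ge0. Qed.

Lemma enorm_ge0 n (v : 'rV[R]_n) : 0 <= enorm v.
Proof. exact: sqrtr_ge0. Qed.

Lemma enormZ n k (v : 'rV[R]_n) : enorm (k *: v) = `|k| * enorm v.
Proof.
by rewrite /enorm dotZl dotZr mulrA -expr2 sqrtrM ?sqr_ge0// sqrtr_sqr.
Qed.

(** The component of [v] orthogonal to [w] has nonnegative squared length. The case [w = 0] is split
    off because that component is computed by a division. *)
Lemma dot_cauchy n (v w : 'rV[R]_n) : dot v w ^+ 2 <= dot v v * dot w w.
Proof.
have [ww0|ww0] := eqVneq (dot w w) 0.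
  suff -> : w = 0 by rewrite !dot0r expr0n mulr0.
  apply/rowP => i; rewrite mxE; apply/eqP; rewrite -sqrf_eq0 expr2; apply/eqP.
  by apply: (psumr_eq0P _ ww0) => // j _; rewrite -expr2 sqr_ge0.
have := dot_ge0 (v - (dot v w / dot w w) *: w); rewrite !dotE (dotC w v) => H.
have {ww0}ww0 : 0 < dot w w by rewrite lt_def ww0 dot_ge0.
rewrite -ler_pdivrMr// -subr_ge0; apply: le_trans H _.
rewrite le_eqVlt; apply/orP; left; apply/eqP; field; exact: lt0r_neq0.
Qed.

Lemma dot_crossl (m v : 'rV[R]_3) : dot m (cross m v) = 0.
Proof.
rewrite /dot !big_ord_recl big_ord0 !mxE.
(* The index sums are reduced modulo 3, so that the six monomials become visible and cancel in
   pairs. *)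
have e01 : ord0 + 1 = 1 :> 'I_3 by exact/val_inj.
have e02 : ord0 + 2 = 2 :> 'I_3 by exact/val_inj.
have -> : lift ord0 (lift ord0 ord0) = 2 :> 'I_3 by exact/val_inj.
have -> : lift ord0 ord0 = 1 :> 'I_3 by exact/val_inj.
have f1 : 1 + 1 = 2 :> 'I_3 by exact/val_inj.
have f2 : 1 + 2 = 0 :> 'I_3 by exact/val_inj.
have f3 : 2 + 1 = 0 :> 'I_3 by exact/val_inj.
have f4 : 2 + 2 = 1 :> 'I_3 by exact/val_inj.
rewrite e01 e02 f1 f2 f3 f4; ring.
Qed.

Lemma dot_crossr (m v : 'rV[R]_3) : dot v (cross m v) = 0.
Proof.
suff -> : cross m v = - cross v m by rewrite dotNr dot_crossl oppr0.
by apply/rowP => i; rewrite !mxE; ring.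
Qed.

(** The quotient by [|m|^2] makes the projection exact for [m] of any nonzero length. This matters
    for the stage [u 1], which need not have unit length. *)
Lemma dot_Pop_self (alpha beta : R) (m v : 'rV[R]_3) :
  dot m m != 0 -> dot m (Pop alpha beta m v) = 0.
Proof.
by move=> m0; rewrite /Pop enorm_sqr !dotE dot_crossl; field.
Qed.

(** The cross product contributes nothing against [v]. What remains is [alpha] times the
    Cauchy-Schwarz gap of [m] and [v], divided by [|m|^2]. *)
Lemma dot_Pop_ge0 (alpha beta : R) (m v : 'rV[R]_3) :
  0 <= alpha -> dot m m != 0 -> 0 <= dot v (Pop alpha beta m v).
Proof.
move=> a0 m0; have mm : 0 < dot m m by rewrite lt_def m0 dot_ge0.
rewrite /Pop enorm_sqr !dotE dot_crossr mulr0 addr0 mulr_ge0// subr_ge0.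
by rewrite (dotC v m) mulrAC -expr2 ler_pdivrMr// mulrC dot_cauchy.
Qed.

End dot_product.

(** * Limits and derivatives of vector-valued maps, coordinate by coordinate *)

Section row_vector_calculus.
Context {R : realType}.

Lemma cvg_rVP {T : Type} {F : set_system T} {FF : Filter F} n
    (f : T -> 'rV[R]_n) (a : 'rV[R]_n) :
  f @ F --> a <-> forall j, f x 0 j @[x --> F] --> a 0 j.
Proof.
split=> [fa j|fa].
  exact: (cvg_comp _ _ fa (@coord_continuous _ _ _ 0 j a)).
apply/cvgrPdist_le => /= e e0; near=> x.
rewrite /Num.Def.normr/= mx_normrE (bigmax_le _ (ltW e0))//= => i _.
rewrite !mxE (ord1 i.1); move: (i.2); near: x; apply: filter_forall => j.
exact: ((cvgrPdist_le _ _).1 (fa j)).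
Unshelve. all: by end_near. Qed.

Lemma cvg_sumr {T : Type} {F : set_system T} {FF : Filter F} I (r : seq I)
    (f : I -> T -> R) (a : I -> R) :
  (forall i, f i @ F --> a i) ->
  \sum_(i <- r) f i x @[x --> F] --> \sum_(i <- r) a i.
Proof.
by move=> fa; apply: cvg_big => //= x; exact: add_continuous.
Qed.

Lemma cvg_dot {T : Type} {F : set_system T} {FF : Filter F} n
    (f g : T -> 'rV[R]_n) (a b : 'rV[R]_n) :
  f @ F --> a -> g @ F --> b -> dot (f x) (g x) @[x --> F] --> dot a b.
Proof.
by move=> /cvg_rVP fa /cvg_rVP gb; apply: cvg_sumr => i; exact: cvgM.
Qed.

Lemma continuous_rVP {T : topologicalType} n (f : T -> 'rV[R]_n) x :
  {for x, continuous f} <->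
  forall j, {for x, continuous (fun y => f y 0 j)}.
Proof. exact: cvg_rVP. Qed.

Lemma continuous_sumr {T : topologicalType} I (r : seq I) (f : I -> T -> R) x :
  (forall i, {for x, continuous (f i)}) ->
  {for x, continuous (fun y => \sum_(i <- r) f i y)}.
Proof. exact: cvg_sumr. Qed.

Lemma continuous_dot {T : topologicalType} n (f g : T -> 'rV[R]_n) x :
  {for x, continuous f} -> {for x, continuous g} ->
  {for x, continuous (fun y => dot (f y) (g y))}.
Proof. exact: cvg_dot. Qed.

Context {V : normedModType R}.
Implicit Types (x v : V).

Lemma is_derive_rVP n (f : V -> 'rV[R]_n) x v (df : 'rV[R]_n) :
  is_derive x v f df <->
  forall j, is_derive x v (fun y => f y 0 j : R) (df 0 j).
Proof.
split=> [[fx <-] j|H].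
  by rewrite derive_mx// mxE; apply/derivableP; exact: (derivable_mxP _ _ _).1.
have fx : derivable f x v.
  by apply/derivable_mxP => i j; rewrite (ord1 i); have [] := H j.
apply: DeriveDef => //; rewrite derive_mx//; apply/rowP => j; rewrite mxE.
by have [] := H j.
Qed.

Lemma is_derive_sumr I (r : seq I) (f : I -> V -> R) x v (df : I -> R) :
  (forall i, is_derive x v (f i) (df i)) ->
  is_derive x v (fun y => \sum_(i <- r) f i y) (\sum_(i <- r) df i).
Proof.
move=> H; elim: r => [|i r IH].
  rewrite big_nil (_ : (fun _ => _) = cst 0); first exact: is_derive_cst.
  by apply/funext => y; rewrite big_nil.
rewrite big_cons (_ : (fun _ => _) = f i + fun y => \sum_(i <- r) f i y).
  exact: is_deriveD.
by apply/funext => y; rewrite big_cons.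
Qed.

Lemma is_derive_dot n (f g : V -> 'rV[R]_n) x v df dg :
  is_derive x v f df -> is_derive x v g dg ->
  is_derive x v (fun y => dot (f y) (g y)) (dot df (g x) + dot (f x) dg).
Proof.
move=> /is_derive_rVP Hf /is_derive_rVP Hg.
rewrite /dot -big_split/=; apply: is_derive_sumr => i.
have Hfi := Hf i; have Hgi := Hg i.
rewrite (_ : (fun y => _) = (fun y => f y 0 i : R) * (fun y => g y 0 i))//.
apply: (is_derive_eq (is_deriveM Hfi Hgi)).
by rewrite /GRing.scale/=; ring.
Qed.

Lemma is_derive_scale n (k : V -> R) (f : V -> 'rV[R]_n) x v dk df :
  is_derive x v k dk -> is_derive x v f df ->
  is_derive x v (fun y => k y *: f y) (dk *: f x + k x *: df).
Proof.
move=> Hk /is_derive_rVP Hf; apply/is_derive_rVP => j.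
have Hfj := Hf j.
rewrite (_ : (fun y => _) = k * (fun y => f y 0 j)); last first.
  by apply/funext => y; rewrite mxE.
apply: (is_derive_eq (is_deriveM Hk Hfj)).
by rewrite !mxE /GRing.scale/=; ring.
Qed.

Lemma differentiable_sumr n (f : 'I_n -> V -> R) x :
  (forall i, differentiable (f i) x) ->
  differentiable (fun y => \sum_i f i y) x.
Proof.
move=> H; rewrite (_ : (fun _ => _) = \sum_i f i); first exact: differentiable_sum.
by apply/funext => y; rewrite fct_sumE.
Qed.

Lemma differentiable_rVP n (f : V -> 'rV[R]_n) x :
  differentiable f x <->
  forall j, differentiable (fun y => f y 0 j : R) x.
Proof.
split=> [df j|H].
  exact: (differentiable_comp df (differentiable_coord _ _ _)).
rewrite (_ : f = \sum_(j < n) fun y => f y 0 j *: delta_mx 0 j).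
  by apply: differentiable_sum => j; exact: differentiableZl.
by apply/funext => y; rewrite fct_sumE -row_sum_delta.
Qed.

Lemma differentiable_dot n (f g : V -> 'rV[R]_n) x :
  differentiable f x -> differentiable g x ->
  differentiable (fun y => dot (f y) (g y)) x.
Proof.
move=> /differentiable_rVP df /differentiable_rVP dg.
by apply: differentiable_sumr => i; exact: differentiableM.
Qed.

Lemma differentiable_scale n (k : V -> R) (f : V -> 'rV[R]_n) x :
  differentiable k x -> differentiable f x ->
  differentiable (fun y => k y *: f y) x.
Proof.
move=> dk /differentiable_rVP df; apply/differentiable_rVP => j.
rewrite (_ : (fun y => _) = (fun y => k y * f y 0 j)).
  exact: differentiableM.
by apply/funext => y; rewrite mxE.
Qed.

End row_vector_calculus.

(** Write [g = f + (g - f)]. Near [x] the second summand vanishes identically, so it expands with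
    zero differential and a remainder that is trivially a little-o. *)
Lemma near_eq_differentiable {R : realType} {V W : normedModType R}
    (f g : V -> W) (x : V) :
  (\near x, f x = g x) -> differentiable f x -> differentiable g x.
Proof.
move=> fg df.
suff dh : differentiable (g - f) x.
  have -> : g = f + (g - f) by rewrite addrC subrK.
  exact: differentiableD.
have h0 : \near x, (g - f) x = 0.
  by near=> y; rewrite !fctE; apply/eqP; rewrite subr_eq0 eq_sym; apply/eqP; near: y.
have e : (g - f) \o shift x = cst ((g - f) x) + \0 +o_ 0 id.
  apply/eqaddoP => eps eps0; near=> y.
  have h0x : g x - f x = 0 by exact: (nbhs_singleton h0).
  rewrite !fctE/= h0x addr0 subr0.
  have -> : g (y + x) - f (y + x) = 0.
    near: y; have := h0; rewrite (near_shift 0 x)/=.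
    by apply: filterS => y; rewrite !fctE/= subr0.
  by rewrite normr0 mulr_ge0// ltW.
apply/diff_locallyP; rewrite (diff_unique _ e); first by split=> //; exact: cst_continuous.
exact: cst_continuous.
Unshelve. all: by end_near. Qed.

Lemma near_eq_continuous {T U : topologicalType} (f g : T -> U) (x : T) :
  (\near x, f x = g x) -> {for x, continuous f} -> {for x, continuous g}.
Proof.
move=> fg; rewrite /prop_for /continuous_at -(nbhs_singleton fg).
by apply: cvg_trans; apply: (@near_eq_cvg _ _ (nbhs x)).
Qed.

(** * Maps of class C^1 on an open set and up to its closure *)

Section C1_functions.
Context {R : realType} {d : nat} {Omega : set 'rV[R]_d}.
Hypothesis openO : open Omega.

Lemma near_open x : Omega x -> \forall y \near x, Omega y.
Proof. by move=> Ox; exact: open_nbhs_nbhs. Qed.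

Lemma near_eq_on {k} (f g : 'rV[R]_d -> 'rV[R]_k) x : Omega x ->
  (forall x, Omega x -> f x = g x) -> \forall y \near x, f y = g y.
Proof. by move=> Ox fg; apply: filterS (near_open Ox) => y; exact: fg. Qed.

Lemma eq_on_partial k (f g : 'rV[R]_d -> 'rV[R]_k) j x :
  (forall x, Omega x -> f x = g x) -> Omega x -> partial j f x = partial j g x.
Proof. by move=> fg Ox; apply: near_eq_derive; exact: near_eq_on. Qed.

Lemma is_derive_partial k (f : 'rV[R]_d -> 'rV[R]_k) j x :
  differentiable f x -> is_derive x (basis_vec R j) f (partial j f x).
Proof. by move=> df; apply/derivableP/diff_derivable. Qed.

Lemma C1_continuous k (f : 'rV[R]_d -> 'rV[R]_k) x :
  C1 Omega f -> Omega x -> {for x, continuous f}.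
Proof. by move=> fC1 /fC1 [df _]; exact: differentiable_continuous. Qed.

(** A formula [h j] for the partial derivative is known inside [Omega] only. As [Omega] is open, it
    holds near each point, and continuity passes from the formula to the derivative. *)
Lemma C1_by_partials k (f : 'rV[R]_d -> 'rV[R]_k)
    (h : 'I_d -> 'rV[R]_d -> 'rV[R]_k) :
  (forall x, Omega x -> differentiable f x) ->
  (forall j x, Omega x -> partial j f x = h j x) ->
  (forall j x, Omega x -> {for x, continuous (h j)}) -> C1 Omega f.
Proof.
move=> df fh ch x Ox; split=> [|j]; first exact: df.
apply: near_eq_continuous (ch j x Ox).
by apply: filterS (near_open Ox) => y Oy; rewrite fh.
Qed.

Lemma eq_on_C1 k (f g : 'rV[R]_d -> 'rV[R]_k) :
  (forall x, Omega x -> f x = g x) -> C1 Omega f -> C1 Omega g.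
Proof.
move=> fg fC1; apply: (@C1_by_partials _ _ (fun j => partial j f)).
- move=> x Ox; have [df _] := fC1 _ Ox; move: df.
  by apply: near_eq_differentiable; exact: near_eq_on.
- by move=> j x Ox; apply: eq_on_partial => // y /fg.
- by move=> j x Ox; have [_] := fC1 _ Ox; exact.
Qed.

Lemma partialD k (f g : 'rV[R]_d -> 'rV[R]_k) j x :
  differentiable f x -> differentiable g x ->
  partial j (f + g) x = partial j f x + partial j g x.
Proof. by move=> df dg; rewrite /partial deriveD//; exact: diff_derivable. Qed.

Lemma partialZ k (f : 'rV[R]_d -> 'rV[R]_k) (a : R) j x :
  differentiable f x -> partial j (a *: f) x = a *: partial j f x.
Proof. by move=> df; rewrite /partial deriveZ//; exact: diff_derivable. Qed.

Lemma partialB k (f g : 'rV[R]_d -> 'rV[R]_k) j x :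
  differentiable f x -> differentiable g x ->
  partial j (f - g) x = partial j f x - partial j g x.
Proof. by move=> df dg; rewrite /partial deriveB//; exact: diff_derivable. Qed.

Lemma C1D k (f g : 'rV[R]_d -> 'rV[R]_k) :
  C1 Omega f -> C1 Omega g -> C1 Omega (f + g).
Proof.
move=> fC1 gC1; apply: (@C1_by_partials _ _ (fun j => partial j f + partial j g)).
- by move=> x Ox; apply: differentiableD; [have [] := fC1 _ Ox|have [] := gC1 _ Ox].
- by move=> j x Ox; rewrite partialD//; [have [] := fC1 _ Ox|have [] := gC1 _ Ox].
- by move=> j x Ox; apply: continuousD; [have [_] := fC1 _ Ox|have [_] := gC1 _ Ox]; exact.
Qed.

Lemma C1Z k (f : 'rV[R]_d -> 'rV[R]_k) (a : R) :
  C1 Omega f -> C1 Omega (a *: f).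
Proof.
move=> fC1; apply: (@C1_by_partials _ _ (fun j => a *: partial j f)).
- by move=> x Ox; apply: differentiableZ; have [] := fC1 _ Ox.
- by move=> j x Ox; rewrite partialZ//; have [] := fC1 _ Ox.
- by move=> j x Ox; apply: continuousZl_tmp; have [_] := fC1 _ Ox; exact.
Qed.

Lemma C1B k (f g : 'rV[R]_d -> 'rV[R]_k) :
  C1 Omega f -> C1 Omega g -> C1 Omega (f - g).
Proof.
move=> fC1 gC1; have -> : f - g = f + (- 1) *: g by rewrite scaleN1r.
exact: (C1D fC1 (C1Z (- 1) gC1)).
Qed.

Lemma C1_closureB k (f g : 'rV[R]_d -> 'rV[R]_k) :
  C1_closure Omega f -> C1_closure Omega g -> C1_closure Omega (f - g).
Proof.
move=> [fc fC1 fe] [gc gC1 ge]; split.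
- exact: within_continuousB.
- exact: C1B.
- move=> j; have [f' [f'c f'E]] := fe j; have [g' [g'c g'E]] := ge j.
  exists (f' - g'); split=> [|x Ox]; first exact: within_continuousB.
  by rewrite !fctE f'E// g'E// partialB//; [have [] := fC1 _ Ox|have [] := gC1 _ Ox].
Qed.

(** Product rule for the fields of Green's identity: there [f j] is the [j]-th partial derivative of
    a stage and [g] is the function it is tested against. *)
Lemma partial_row_dot k (f : 'I_d -> 'rV[R]_d -> 'rV[R]_k) g i j x :
  (forall j, differentiable (f j) x) -> differentiable g x ->
  partial i (fun y => \row_j dot (f j y) (g y)) x 0 j =
  dot (partial i (f j) x) (g x) + dot (f j x) (partial i g x).
Proof.
move=> df dg.
have H : is_derive x (basis_vec R i) (fun y => \row_j dot (f j y) (g y))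
    (\row_j (dot (partial i (f j) x) (g x) + dot (f j x) (partial i g x))).
  apply/is_derive_rVP => l.
  rewrite (_ : (fun y => _) = (fun y => dot (f l y) (g y))); last first.
    by apply/funext => y; rewrite mxE.
  by rewrite mxE; apply: is_derive_dot; exact: is_derive_partial.
by rewrite /partial derive_val mxE.
Qed.

Lemma C1_row_dot k (f : 'I_d -> 'rV[R]_d -> 'rV[R]_k) g :
  (forall j, C1 Omega (f j)) -> C1 Omega g ->
  C1 Omega (fun x => \row_j dot (f j x) (g x)).
Proof.
move=> fC1 gC1.
have df x j : Omega x -> differentiable (f j) x.
  by move=> Ox; have [] := fC1 j _ Ox.
have dg x : Omega x -> differentiable g x.
  by move=> Ox; have [] := gC1 _ Ox.
apply: (@C1_by_partials _ _ (fun i x => \row_j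
  (dot (partial i (f j) x) (g x) + dot (f j x) (partial i g x)))).
- move=> x Ox; apply/differentiable_rVP => j.
  rewrite (_ : (fun y => _) = (fun y => dot (f j y) (g y))); last first.
    by apply/funext => y; rewrite mxE.
  by apply: differentiable_dot; [exact: df|exact: dg].
- move=> i x Ox; apply/rowP => j; rewrite mxE partial_row_dot//; last exact: dg.
  by move=> ?; exact: df.
- move=> i x Ox; apply/continuous_rVP => j.
  rewrite (_ : (fun y => _) = (fun y =>
    dot (partial i (f j) y) (g y) + dot (f j y) (partial i g y))); last first.
    by apply/funext => y; rewrite mxE.
  have [_ cg] := gC1 _ Ox; have [_ cf] := fC1 j _ Ox.
  exact: (continuousD (continuous_dot (cf i) (C1_continuous gC1 Ox))
    (continuous_dot (C1_continuous (fC1 j) Ox) (cg i))).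
Qed.

End C1_functions.

(** * Measurability and boundedness of continuous functions, finiteness of Lebesgue measure *)

Section borel_rV.
Context {R : realType} {d : nat}.
Implicit Types (D : set 'rV[R]_d).

Lemma within_continuous_measurable D (f : 'rV[R]_d -> R) :
  measurable D -> {within D, continuous f} -> measurable_fun D f.
Proof.
move=> mD /continuousP cf; apply: (measurability _ (RGenOpens.measurableE R)).
move=> _ [_ [a [b ->] <-]].
have /open_subspaceP[V oV VE] := cf _ (@interval_open R (BRight a) (BLeft b) isT isT).
rewrite setIC -VE.
by apply: measurableI => //; exact: open_measurable_mx.
Qed.

Lemma open_continuous_measurable D (f : 'rV[R]_d -> R) :
  open D -> (forall x, D x -> {for x, continuous f}) -> measurable_fun D f.
Proof.
move=> oD cf; apply: within_continuous_measurable; first exact: open_measurable_mx.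
by rewrite continuous_open_subspace// => x /[1!inE]; exact: cf.
Qed.

Lemma closed_measurable_mx D : closed D -> measurable D.
Proof.
move=> cD; rewrite -(setCK D); apply: measurableC; apply: open_measurable_mx.
exact: closed_openC.
Qed.

Lemma measurable_boundary D : measurable (boundary D).
Proof.
apply: measurableD; last by apply: open_measurable_mx; exact: open_interior.
by apply: closed_measurable_mx; exact: closed_closure.
Qed.

Lemma bounded_lebesgue_lty D :
  measurable D -> bounded_set D -> (lebesgue_rV d D < +oo)%E.
Proof.
move=> mD [M [_ bD]].
(* Every number strictly above [M] bounds [D], and [M] may be negative, whence the bound [|M| + 1].
   One more unit is added because the box is open on its lower side. *)
pose a : 'rV[R]_d := const_mx (- (`|M| + 2)).
pose b : 'rV[R]_d := const_mx (`|M| + 2).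
have ab i : a 0 i <= b 0 i by rewrite !mxE; have := normr_ge0 M; lra.
pose B := [set x : 'rV[R]_d | forall i, a 0 i < x 0 i <= b 0 i].
apply: (@le_lt_trans _ _ (lebesgue_rV d B)); last by rewrite lebesgue_rV_box// ltry.
apply: le_measure; rewrite ?inE//.
  rewrite (_ : B = \bigcap_(i in [set: 'I_d])
      ((fun x : 'rV[R]_d => x 0 i) @^-1` `]a 0 i, b 0 i]%classic)).
    apply: fin_bigcap_measurable => // i _.
    by rewrite -[X in measurable X]setTI; exact: measurable_coord.
  apply/seteqP; split => x /= xab i; first by rewrite /= in_itv/= => _; exact: xab.
  by have := xab i I; rewrite /= in_itv.
move=> x Dx i; rewrite !mxE.
have Mx : `|x| <= `|M| + 1 by apply: bD => //; have := ler_norm M; lra.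
have {Mx} : `|x 0 i| <= `|M| + 1.
  apply: le_trans Mx; rewrite [leRHS]/Num.Def.normr/= mx_normrE.
  exact: (le_bigmax _ (fun ij : 'I_1 * 'I_d => `|x ij.1 ij.2|) (0, i)).
rewrite ler_norml => /andP[x1 x2]; apply/andP; split; lra.
Qed.

Lemma closure_bounded D : bounded_set D -> bounded_set (closure D).
Proof.
move=> [M [Mr bD]]; exists M; split=> // x Mx.
have : closure D `<=` closed_ball_ Num.norm 0 x.
  rewrite closureE; apply: smallest_sub; first exact: closed_closed_ball_.
  by move=> y Dy; rewrite /closed_ball_/= sub0r normrN bD.
by move=> H y /H; rewrite /closed_ball_/= sub0r normrN.
Qed.

(** Heine-Borel: the closure of [D] is compact, hence so is its image under [f]. *)
Lemma within_continuous_bounded D (f : 'rV[R]_d -> R) : bounded_set D ->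
  {within closure D, continuous f} -> [bounded f x | x in D].
Proof.
move=> bD cf.
have cD : compact (closure D).
  by apply: bounded_closed_compact; [exact: closure_bounded|exact: closed_closure].
have [M [Mr fM]] := compact_bounded (continuous_compact cf cD).
exists M; split=> // x Mx y Dy; apply: fM => //.
by exists y => //; exact: subset_closure.
Qed.

Lemma eq_on_bounded D (f g : 'rV[R]_d -> R) : (forall x, D x -> f x = g x) ->
  [bounded f x | x in D] -> [bounded g x | x in D].
Proof.
move=> fg [M [Mr fM]]; exists M; split=> // x Mx y Dy /=.
by rewrite -fg//; exact: fM.
Qed.

End borel_rV.

(** * Green's first identity *)

Section integration_by_parts.
Context {R : realType} {d : nat}.

Lemma derive_partialE k (f : 'rV[R]_d -> 'rV[R]_k) x v :
  differentiable f x -> 'D_v f x = \sum_j v 0 j *: partial j f x.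
Proof.
move=> df; rewrite deriveE// {1}(row_sum_delta v) linear_sum.
by apply: eq_bigr => j _; rewrite linearZ /partial deriveE.
Qed.

(** Frobenius inner product of the two Jacobians, the polarization of [grad_sqr]. *)
Definition grad_dot k (f g : 'rV[R]_d -> 'rV[R]_k) x :=
  \sum_j dot (partial j f x) (partial j g x).

(** The partial derivatives are replaced by their continuous extensions, which are bounded on the
    compact closure. *)
Lemma C1_closure_bounded_grad (Omega : set 'rV[R]_d) k
    (f g : 'rV[R]_d -> 'rV[R]_k) : bounded_set Omega ->
  C1_closure Omega f -> C1_closure Omega g ->
  [bounded grad_dot f g x | x in Omega].
Proof.
move=> bO [_ _ /choice[f' f'P]] [_ _ /choice[g' g'P]].
apply: (@eq_on_bounded _ _ _ (fun x => \sum_j dot (f' j x) (g' j x))).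
  by move=> x Ox; apply: eq_bigr => j _; rewrite (f'P j).2// (g'P j).2.
apply: within_continuous_bounded => // x; apply: continuous_sumr => j.
by apply: continuous_dot; [exact: (f'P j).1|exact: (g'P j).1].
Qed.

Lemma C1_measurable_grad (Omega : set 'rV[R]_d) k
    (f g : 'rV[R]_d -> 'rV[R]_k) : open Omega ->
  C1 Omega f -> C1 Omega g -> measurable_fun Omega (grad_dot f g).
Proof.
move=> oO fC1 gC1; apply: open_continuous_measurable => // x Ox.
have [_ cf] := fC1 _ Ox; have [_ cg] := gC1 _ Ox.
by apply: continuous_sumr => j; exact: (continuous_dot (cf j) (cg j)).
Qed.

Lemma C1_closure_integrable_grad (Omega : set 'rV[R]_d) k
    (f g : 'rV[R]_d -> 'rV[R]_k) : open Omega -> bounded_set Omega ->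
  C1_closure Omega f -> C1_closure Omega g ->
  (lebesgue_rV d).-integrable Omega (fun x => (grad_dot f g x)%:E).
Proof.
move=> oO bO fC gC; have mO := open_measurable_mx oO.
apply: (@measurable_bounded_integrable _ _ _ _ (grad_dot f g)) => //.
- exact: bounded_lebesgue_lty.
- by case: fC gC => _ fC _ [_ gC _]; exact: C1_measurable_grad.
- exact: C1_closure_bounded_grad.
Qed.

Context {Omega : set 'rV[R]_d} {sigma : {finite_measure set 'rV[R]_d -> \bar R}}
  {nu : 'rV[R]_d -> 'rV[R]_d}.
Hypothesis rO : regular_domain Omega sigma nu.
Let oO : open Omega. Proof. by case: rO. Qed.
Let bO : bounded_set Omega. Proof. by case: rO. Qed.

(** Inside [Omega] the derivative along the fixed vector [nu x] is the combination of the [G j] with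
    coefficients [nu x 0 j]. Its limit at [x] is the value of the continuous extension, and by the
    Neumann condition it is 0. *)
Lemma normal_derivative_eq0 (u : 'rV[R]_d -> 'rV[R]_3)
    (G : 'I_d -> 'rV[R]_d -> 'rV[R]_3) x : C1 Omega u ->
  (forall j, {within closure Omega, continuous (G j)} /\
    forall x, Omega x -> G j x = partial j u x) -> boundary Omega x ->
  'D_(nu x) u @ within Omega (nbhs x) --> (0 : 'rV[R]_3) ->
  \sum_j nu x 0 j *: G j x = 0.
Proof.
move=> uC1 GP [clx _] Du0.
(* Limits from inside are unique because [x] lies in the closure of [Omega]. *)
have PF : ProperFilter (within Omega (nbhs x)) by exact: within_nbhs_proper.
apply/esym; apply: (cvg_unique _ Du0) => //.
have DE : \forall y \near within Omega (nbhs x),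
    \sum_j nu x 0 j *: G j y = 'D_(nu x) u y.
  apply: filterS (withinT Omega (nbhs_filter x)) => y Oy.
  have [du _] := uC1 _ Oy; rewrite derive_partialE//.
  by apply: eq_bigr => j _; rewrite (GP j).2.
apply: cvg_trans (near_eq_cvg DE) _.
apply/cvg_rVP => l.
rewrite summxE (_ : (fun y => _) = (fun y => \sum_j nu x 0 j * G j y 0 l)).
  under eq_bigr do rewrite mxE.
  apply: cvg_sumr => j; apply: cvgM; first exact: cvg_cst.
  move: l; apply/cvg_rVP.
  have /subspace_continuousP/(_ _ clx) := (GP j).1.
  apply: cvg_trans; apply: cvg_app; apply: within_subset.
  exact: subset_closure.
by apply/funext => y; rewrite summxE; apply: eq_bigr => j _; rewrite mxE.
Qed.

(** The divergence theorem is applied to the field with components (d_j u) . w. Its divergence is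
    the integrand, and its flux through the boundary is (d_nu u) . w, in which one factor vanishes
    almost everywhere. *)
Lemma greens_identity (u w : 'rV[R]_d -> 'rV[R]_3) :
  stage_regular Omega u -> C1_closure Omega w ->
  (forall x, boundary Omega x -> w x = 0) \/
    satisfies_bc Omega sigma nu Neumann u ->
  (lebesgue_rV d).-integrable Omega
    (fun x => (dot (laplacian u x) (w x) + grad_dot u w x)%:E) /\
  (\int[lebesgue_rV d]_(x in Omega)
    (dot (laplacian u x) (w x) + grad_dot u w x)%:E = 0)%E.
Proof.
move=> [uC [uC1 uC2] lapu] wC bc.
have mO : measurable Omega := open_measurable_mx oO.
have [cw wC1 _] := wC.
have [_ _ /choice[G GP]] := uC.
(* The extensions [G j] replace the partial derivatives, since the field has to be continuous up to
   the boundary. Inside [Omega] the two fields agree. *)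
pose F x := \row_j dot (G j x) (w x).
have FE x : Omega x -> \row_j dot (partial j u x) (w x) = F x.
  by move=> Ox; apply/rowP => j; rewrite !mxE (GP j).2.
have FC1 : C1 Omega F by apply: (eq_on_C1 oO FE); exact: C1_row_dot.
have cF : {within closure Omega, continuous F}.
  move=> x; apply/continuous_rVP => j.
  rewrite (_ : (fun y => _) = (fun y => dot (G j y) (w y))).
    by apply: continuous_dot; [exact: (GP j).1|exact: cw].
  by apply/funext => y; rewrite mxE.
have divE x : Omega x -> divergence F x =
    dot (laplacian u x) (w x) + grad_dot u w x.
  move=> Ox; rewrite /divergence /laplacian dot_suml /grad_dot -big_split/=.
  apply: eq_bigr => j _; rewrite -(eq_on_partial oO j FE Ox) partial_row_dot//.
    by move=> l; have [] := uC2 l _ Ox.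
  by have [] := wC1 _ Ox.
have hi : (lebesgue_rV d).-integrable Omega
    (fun x => (dot (laplacian u x) (w x) + grad_dot u w x)%:E).
  have -> : (fun x => (dot (laplacian u x) (w x) + grad_dot u w x)%:E) =
    (fun x => (\sum_(i < 3) (laplacian u x 0 i)%:E * (w x 0 i)%:E)
       + (grad_dot u w x)%:E)%E.
    apply/funext => x; rewrite EFinD; congr (_ + _)%E.
    by rewrite sumEFin.
  apply: integrableD => //; last exact: C1_closure_integrable_grad.
  (* Each summand is an integrable component of the Laplacian times a bounded component of [w]. *)
  apply: integrable_sum => // i _.
  apply: (@integrableMl _ _ _ _ _ _ _ (fun x => w x 0 i)) => //.
    apply: open_continuous_measurable => // x Ox.
    exact: ((continuous_rVP _ _).1 (C1_continuous wC1 Ox)).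
  apply: within_continuous_bounded => // x.
  exact: ((continuous_rVP _ _).1 (cw x)).
split=> //.
under eq_integral => x /[1!inE] Ox do rewrite -divE//.
rewrite (divergence_theorem rO)//; last first.
  by apply: eq_integrable hi => // x /[1!inE] Ox; rewrite divE.
have wnu0 : {ae sigma, forall x, boundary Omega x ->
    w x = 0 \/ \sum_j nu x 0 j *: G j x = 0}.
  case: bc => [w0|]; first by apply: aeW => x bx; left; exact: w0.
  apply: filterS => x Du0 bx; right.
  exact: (normal_derivative_eq0 uC1 GP bx (Du0 bx)).
rewrite (@ae_eq_integral _ _ _ sigma (boundary Omega) (cst 0%E)).
- exact: integral0.
- exact: measurable_boundary.
- apply/measurable_EFinP; apply: measurable_sum => j; apply: measurable_funM.
    apply: within_continuous_measurable; first exact: measurable_boundary.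
    apply: (@continuous_subspaceW _ _ _ (closure Omega)); first by move=> x [].
    by move=> x; exact: ((continuous_rVP _ _).1 (cF x)).
  exact: (measurableT_comp (measurable_coord j) (normal_measurable rO)).
- exact: measurable_cst.
- apply: filterS wnu0 => x wnu0 bx; congr EFin.
  (* Exchanging the two sums exhibits the flux as the extended normal derivative of [u] dotted with
     [w]. *)
  have -> : dot (F x) (nu x) = dot (\sum_j nu x 0 j *: G j x) (w x).
    rewrite dot_suml; apply: eq_bigr => j _.
    by rewrite mxE dotZl mulrC.
  by case: (wnu0 bx) => ->; rewrite ?dot0r ?dot0l.
Qed.

End integration_by_parts.

(** * Normalization of a map of length at least 1 *)

Section normalization.
Context {R : realType} {d n : nat} {Omega : set 'rV[R]_d}.
Hypothesis oO : open Omega.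
Variable m : 'rV[R]_d -> 'rV[R]_n.
Hypothesis mC1 : C1 Omega m.
Hypothesis m_ge1 : forall x, Omega x -> 1 <= dot (m x) (m x).

Let N x := enorm (m x).
Let q x := (N x)^-1 *: m x.

Let N_gt0 x : Omega x -> 0 < N x.
Proof. by move=> /m_ge1 ?; rewrite sqrtr_gt0 (lt_le_trans ltr01). Qed.

Let dN x : Omega x -> differentiable N x.
Proof.
move=> Ox; have [dm _] := mC1 Ox; have m1 := m_ge1 Ox.
apply: (@differentiable_comp _ _ _ _ (fun y => dot (m y) (m y)) Num.sqrt).
  exact: differentiable_dot.
apply/derivable1_diffP.
by have [] := is_derive1_sqrt (lt_le_trans ltr01 m1).
Qed.

Let dq x : Omega x -> differentiable q x.
Proof.
move=> Ox; have [dm _] := mC1 Ox; apply: differentiable_scale => //.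
by apply: differentiableV; [exact: dN|rewrite gt_eqF// N_gt0].
Qed.

Let q_unit x : Omega x -> dot (q x) (q x) = 1.
Proof.
move=> Ox; rewrite /q !dotE -(enorm_sqr (m x)) -/(N x).
by field; rewrite gt_eqF// N_gt0.
Qed.

(* Differentiating [m = N q] and [q . q = 1] gives [dN = q . dm]. *)
Let partial_normalize j x : Omega x -> partial j q x =
  (N x)^-1 *: (partial j m x - dot (q x) (partial j m x) *: q x).
Proof.
move=> Ox; have [dm _] := mC1 Ox; have N0 := N_gt0 Ox.
have Hq := is_derive_partial j (dq Ox).
have HN : is_derive x (basis_vec R j) N ('D_(basis_vec R j) N x).
  by apply/derivableP/diff_derivable; exact: dN.
have qdq : dot (q x) (partial j q x) = 0.
  (* [q . q] is constant on [Omega] only, hence near [x], which suffices. The product rule gives the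
     same derivative as [2 (q . dq)]. *)
  have : is_derive x (basis_vec R j) (fun y => dot (q y) (q y)) 0.
    apply: near_eq_is_derive (is_derive_cst (1 : R) _ _).
    by apply: filterS (near_open oO Ox) => y Oy; rewrite q_unit.
  move=> [_]; have [_ ->] := is_derive_dot Hq Hq.
  by rewrite (dotC (partial j q x)) => /eqP; rewrite -mulr2n mulrn_eq0/= => /eqP.
have dmE : partial j m x = 'D_(basis_vec R j) N x *: q x + N x *: partial j q x.
  have : is_derive x (basis_vec R j) m
      ('D_(basis_vec R j) N x *: q x + N x *: partial j q x).
    apply: near_eq_is_derive (is_derive_scale HN Hq).
    apply: filterS (near_open oO Ox) => y Oy.
    by rewrite scalerA mulfV ?scale1r// gt_eqF// N_gt0.
  by move=> [_].
rewrite dmE; move: (q_unit Ox) qdq; move: (partial j q x) (q x) => p qx qx1 qp0.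
rewrite !dotE qx1 qp0 mulr0 addr0 mulr1 (addrC (_ *: qx)) addrK.
by rewrite scalerA mulVf ?scale1r// gt_eqF.
Qed.

(** Used for the measurability of the energy density of the new iterate. *)
Lemma C1_normalize : C1 Omega (fun x => (enorm (m x))^-1 *: m x).
Proof.
apply: (C1_by_partials oO dq partial_normalize) => j x Ox.
have [dm cm] := mC1 Ox; have N0 := N_gt0 Ox.
have cq := differentiable_continuous (dq Ox).
apply: continuousZ.
  by apply: continuousV; [rewrite gt_eqF|exact: differentiable_continuous (dN Ox)].
apply: continuousB; first exact: cm.
by apply: continuousZ => //; apply: continuous_dot => //; exact: cm.
Qed.

(** Each partial derivative of [q] arises from that of [m] by removing the component along [q] and
    dividing by [N >= 1]. Neither operation increases the length. *)
Lemma grad_sqr_normalize_le x : Omega x ->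
  grad_sqr (fun x => (enorm (m x))^-1 *: m x) x <= grad_sqr m x.
Proof.
move=> Ox; apply: ler_sum => j _; rewrite -/q partial_normalize// !enorm_sqr.
move: (q_unit Ox); move: (partial j m x) (q x) => p qx qx1.
rewrite !dotE qx1 (dotC p qx).
have N1 : 1 <= N x ^+ 2 by rewrite enorm_sqr m_ge1.
rewrite [leLHS](_ : _ = (N x ^+ 2)^-1 * (dot p p - dot qx p ^+ 2)); last first.
  by field; rewrite gt_eqF// N_gt0.
rewrite ler_pdivrMl ?(lt_le_trans ltr01)//.
apply: (@le_trans _ _ (dot p p)); first by rewrite gerBl sqr_ge0.
by rewrite ler_peMl// dot_ge0.
Qed.

End normalization.

(** * Order conditions and pointwise algebra of the stages *)

Section scheme.
Context {R : realType}.

Lemma tableau_second_order :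
  A2 *m onev = c2 :> 'cV[R]_2 /\ second_order (A2 : 'M[R]_2) D2 b2.
Proof.
have Ac : A2 *m onev = c2 :> 'cV[R]_2.
  apply/colP => i; rewrite !mxE !big_ord_recl big_ord0 !mxE /=.
  by case: (i == 0); field.
split=> //; split; rewrite -?mulmxA ?Ac !mxE !big_ord_recl big_ord0 !mxE /=.
- by field.
- by rewrite !big_ord_recl !big_ord0 !mxE/=; field.
- by rewrite !big_ord_recl !big_ord0 !mxE/=; field.
Qed.

Context {d : nat} {Omega : set 'rV[R]_d} {alpha beta tau : R}
  {mn : 'rV[R]_d -> 'rV[R]_3} {u : nat -> 'rV[R]_d -> 'rV[R]_3}.

Let L i := laplacian (u i).
Let S0 x := Pop alpha beta (u 0%N x) (L 1 x).
(** The second row [(-1, 2)] of [D2] produces the Laplacian of [2 u_2 - u_1]. *)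
Let S1 x := Pop alpha beta (u 1%N x) (2 *: L 2 x - L 1 x).

(** Since [A2] is diagonal, the second increment involves [S1] alone. It is therefore orthogonal to
    [u 1], the point at which the projection in [S1] is taken. *)
Lemma stage_equations x : imex_stages alpha beta tau A2 D2 Omega mn u ->
  Omega x ->
  [/\ u 1%N x = u 0%N x + tau *: S0 x,
      u 2%N x = u 0%N x + (tau / 2) *: S1 x &
      imex_update alpha beta tau b2 D2 u x =
        u 0%N x + (tau / 2) *: S0 x + (tau / 2) *: S1 x].
Proof.
move=> [_ st] Ox.
have sl0 : imex_slope alpha beta D2 u ord0 x = S0 x.
  rewrite /imex_slope big_mkcond !big_ord_recl big_ord0 !mxE/=.
  by rewrite addr0 addr0 scale1r.
have sl1 : imex_slope alpha beta D2 u (lift ord0 ord0) x = S1 x.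
  rewrite /imex_slope big_mkcond !big_ord_recl big_ord0 !mxE/=.
  rewrite /S1 /L; move: (laplacian (u 1%N) x) (laplacian (u 2%N) x) => a b.
  by rewrite addr0 scaleN1r addrC.
have e1 := st ord0 x Ox; have e2 := st (lift ord0 ord0) x Ox.
rewrite big_mkcond !big_ord_recl big_ord0 sl0 !mxE/= in e1.
rewrite big_mkcond !big_ord_recl big_ord0 sl0 sl1 !mxE/= in e2.
move: (S0 x) (S1 x) sl0 sl1 e1 e2 => s0 s1 sl0 sl1.
rewrite !addr0 scale0r add0r scale1r scalerA => -> ->; split=> //.
rewrite /imex_update !big_ord_recl big_ord0 sl0 sl1 !mxE/=.
by rewrite addr0 scalerDr !scalerA addrA.
Qed.

Hypothesis stages : imex_stages alpha beta tau A2 D2 Omega mn u.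
Hypothesis unit0 : forall x, Omega x -> enorm (mn x) = 1.

Let u0_unit x : Omega x -> dot (u 0%N x) (u 0%N x) = 1.
Proof. by move=> Ox; rewrite stages.1 -enorm_sqr unit0// expr1n. Qed.

Let S0_orth x : Omega x -> dot (u 0%N x) (S0 x) = 0.
Proof. by move=> Ox; apply: dot_Pop_self; rewrite u0_unit// oner_neq0. Qed.

(** Pythagoras: the increment [tau S0] is orthogonal to [u 0], so [|u_1|^2 = 1 + tau^2 |S0|^2]. *)
Let u1_neq0 x : Omega x -> dot (u 1%N x) (u 1%N x) != 0.
Proof.
move=> Ox; have [-> _ _] := stage_equations stages Ox.
move: (S0 x) (S0_orth Ox) => s orth; rewrite !dotE u0_unit// (dotC s) orth.
by rewrite gt_eqF//; have := sqr_ge0 tau; have := dot_ge0 s; nra.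
Qed.

(** Expand [u_1 . S1 = 0] with [u_1 = u_0 + tau S0]. *)
Let S1_orth x : Omega x ->
  dot (u 0%N x) (S1 x) = - tau * dot (S0 x) (S1 x).
Proof.
move=> Ox; have : dot (u 1%N x) (S1 x) = 0 by apply/dot_Pop_self/u1_neq0.
have [-> _ _] := stage_equations stages Ox.
move: (S0 x) (S1 x) => s0 s1; rewrite !dotE => H.
by rewrite mulNr; apply/eqP; rewrite -addr_eq0 H.
Qed.

(* [|update|^2 = 1 + |(tau/2) (S0 - S1)|^2] *)
Lemma imex_update_ge1 x : Omega x ->
  1 <= dot (imex_update alpha beta tau b2 D2 u x)
           (imex_update alpha beta tau b2 D2 u x).
Proof.
move=> Ox; have [_ _ ->] := stage_equations stages Ox.
move: (S0 x) (S1 x) (S0_orth Ox) (S1_orth Ox) => s0 s1 orth0 orth1.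
(* The mixed term of the expansion is [(tau^2 / 2) S0 . S1]. The term
   [tau u_0 . S1 = - tau^2 S0 . S1] reverses its sign and so completes this square. *)
have := dot_ge0 ((tau / 2) *: (s0 - s1)).
rewrite !dotE u0_unit// !(dotC _ (u 0%N x)) orth0 orth1 (dotC s1).
lra.
Qed.

(** Substituting the increments [tau S0] and [(tau / 2) S1] gives [tau / 2] times the sum of
    [L1 . S0] and [(2 L2 - L1) . S1]. Both have the form [v . P(m) v]. *)
Lemma stage_dissipation x : Omega x -> 0 < alpha -> 0 < tau ->
  0 <= 2^-1 * dot (L 1 x) (u 1%N x - u 0%N x) +
       2 * dot (L 2 x) (u 2%N x - u 0%N x) -
       dot (L 1 x) (u 2%N x - u 0%N x).
Proof.
move=> Ox a0 t0; have [-> -> _] := stage_equations stages Ox.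
rewrite !(addrC (u 0%N x)) !addrK.
have h0 : 0 <= dot (L 1 x) (S0 x).
  by apply: dot_Pop_ge0; rewrite ?ltW// u0_unit// oner_neq0.
have h1 : 0 <= dot (2 *: L 2 x - L 1 x) (S1 x).
  by apply: dot_Pop_ge0; rewrite ?ltW// u1_neq0.
move: (L 1 x) (L 2 x) (S0 x) (S1 x) h0 h1 => l1 l2 s0 s1 h0.
by rewrite !dotE => h1; nra.
Qed.

End scheme.

(** * Linear combinations of integrable functions with zero integral *)

Section zero_integral.
Context {disp : measure_display} {T : measurableType disp} {R : realType}
  {mu : {measure set T -> \bar R}} {D : set T}.
Hypothesis mD : measurable D.

Definition zero_integral (f : T -> R) :=
  mu.-integrable D (EFin \o f) /\ (\int[mu]_(x in D) (f x)%:E = 0)%E.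

Lemma zero_integralD f g :
  zero_integral f -> zero_integral g -> zero_integral (f \+ g).
Proof.
move=> [fi f0] [gi g0]; split.
  rewrite (_ : _ \o _ = (EFin \o f) \+ (EFin \o g))%E//.
  exact: integrableD.
by rewrite integralD_EFin// f0 g0 adde0.
Qed.

Lemma zero_integralZ k f : zero_integral f -> zero_integral (fun x => k * f x).
Proof.
move=> [fi f0]; split; first exact: (integrableZl mD k fi).
by under eq_integral do rewrite EFinM; rewrite integralZl// f0 mule0.
Qed.

End zero_integral.

(** * Unit length and energy decay for one step *)

Section energy.
Context {R : realType} {d : nat} {Omega : set 'rV[R]_d}
  {sigma : {finite_measure set 'rV[R]_d -> \bar R}} {nu : 'rV[R]_d -> 'rV[R]_d}
  {bc : boundary_condition R d} {alpha beta tau : R}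
  {mn : 'rV[R]_d -> 'rV[R]_3} {u : nat -> 'rV[R]_d -> 'rV[R]_3}.
Hypothesis rO : regular_domain Omega sigma nu.
Hypothesis alpha_gt0 : 0 < alpha.
Hypothesis tau_gt0 : 0 < tau.
Hypothesis mnC : C1_closure Omega mn.
Hypothesis unit0 : forall x, Omega x -> enorm (mn x) = 1.
Hypothesis stages : imex_stages alpha beta tau A2 D2 Omega mn u.
Hypothesis reg : forall i, (1 <= i <= 2)%N -> stage_regular Omega (u i).
Hypothesis ubc : forall i, (i <= 2)%N -> satisfies_bc Omega sigma nu bc (u i).

Let oO : open Omega. Proof. by case: rO. Qed.
Let bO : bounded_set Omega. Proof. by case: rO. Qed.
Let mO : measurable Omega. Proof. exact: open_measurable_mx. Qed.
Let u0E : u 0%N = mn. Proof. exact: stages.1. Qed.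
Let next := imex_next alpha beta tau b2 D2 u.

Let w i := u i - u 0%N.
(** On [Omega] this is the unnormalized update. Written through the stages it is visibly C^1,
    whereas the update formula contains Laplacians, which are only continuous. *)
Let m := u 0%N + 2^-1 *: w 1 + w 2.

Let uC i : (i <= 2)%N -> C1_closure Omega (u i).
Proof. by case: i => [|i] i2; [rewrite u0E|have [] := @reg i.+1 i2]. Qed.

Let du i x : (i <= 2)%N -> Omega x -> differentiable (u i) x.
Proof. by move=> /uC[_ uC1 _] Ox; have [] := uC1 _ Ox. Qed.

Let updateE x : Omega x -> m x = imex_update alpha beta tau b2 D2 u x.
Proof.
move=> Ox; have [e1 e2 ->] := stage_equations stages Ox.
move: (Pop _ _ (u 1%N x) _) (Pop _ _ _ _) e1 e2 => s1 s0 e1 e2.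
rewrite /m /w !fctE.
have -> : u 1%N x - u 0%N x = tau *: s0 by rewrite e1 addrC addKr.
have -> : u 2%N x - u 0%N x = (tau / 2) *: s1 by rewrite e2 addrC addKr.
by rewrite scalerA mulrC.
Qed.

Let m_ge1 x : Omega x -> 1 <= dot (m x) (m x).
Proof. by move=> Ox; rewrite updateE//; exact: (imex_update_ge1 stages unit0). Qed.

Let mC1 : C1 Omega m.
Proof.
have [_ c0 _] := @uC 0 isT; have [_ c1 _] := @uC 1 isT.
have [_ c2 _] := @uC 2 isT.
by apply: (C1D oO (C1D oO c0 (C1Z oO _ (C1B oO c1 c0))) (C1B oO c2 c0)).
Qed.

Let nextE x : Omega x -> (enorm (m x))^-1 *: m x = next x.
Proof. by move=> Ox; rewrite updateE. Qed.

Lemma imex_next_unit x : Omega x -> enorm (next x) = 1.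
Proof.
move=> Ox; rewrite -nextE// enormZ ger0_norm ?invr_ge0 ?enorm_ge0// mulVf//.
by rewrite gt_eqF// sqrtr_gt0 (lt_le_trans ltr01)// m_ge1.
Qed.

Let h i j x := dot (laplacian (u i) x) (w j x) + grad_dot (u i) (w j) x.

(** Under Dirichlet conditions [w j] vanishes on the boundary because [u j] and [u 0] share their
    data. Under Neumann conditions the normal derivative of [u i] vanishes. *)
Let zh i j : (1 <= i <= 2)%N -> (j <= 2)%N ->
  zero_integral (mu := lebesgue_rV d) (D := Omega) (h i j).
Proof.
move=> i12 j2; apply: (greens_identity rO (reg i12)).
  exact: (C1_closureB oO (uC j2) (@uC 0 isT)).
case: bc ubc => [g|] H; last by right; apply: H; case/andP: i12.
by left => x bx; rewrite /w !fctE (H _ j2 _ bx) (H 0%N isT _ bx) subrr.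
Qed.

(** The weights come from half of the gradient identity: [(a + x) . x / 2 + (a + 2y - x) . y], where
    [a + x] is the gradient of [u 1] and [a + 2y - x] that of [2 u_2 - u_1]. *)
Let H x := 2^-1 * h 1 1 x + 2 * h 2 2 x + (- 1) * h 1 2 x.

Let zH : zero_integral (mu := lebesgue_rV d) (D := Omega) H.
Proof.
apply: (zero_integralD mO); first apply: (zero_integralD mO).
- by apply: (zero_integralZ mO); exact: zh.
- by apply: (zero_integralZ mO); exact: zh.
- by apply: (zero_integralZ mO); exact: zh.
Qed.

Let grad_sqrE k (f : 'rV[R]_d -> 'rV[R]_k) : grad_sqr f = grad_dot f f.
Proof. by apply/funext => x; apply: eq_bigr => j _; rewrite enorm_sqr. Qed.

(* With [a], [x], [y] the gradients of [u 0], [w 1], [w 2]: [|a + x/2 + y|^2 =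
   |a|^2 + (a + x).x + 2 (a + 2y - x).y - 3 |x/2 - y|^2]. *)
Let grad_update_le x : Omega x -> 2^-1 * grad_sqr m x <= 2^-1 * grad_sqr mn x +
  (2^-1 * grad_dot (u 1%N) (w 1) x + 2 * grad_dot (u 2%N) (w 2) x -
   grad_dot (u 1%N) (w 2) x).
Proof.
move=> Ox; have d0 := @du 0 x isT Ox.
have d1 := @du 1 x isT Ox; have d2 := @du 2 x isT Ox.
rewrite !grad_sqrE /grad_dot !mulr_sumr -sumrN -!big_split/=.
apply: ler_sum => j _; rewrite -u0E.
have dw1 : partial j (w 1) x = partial j (u 1%N) x - partial j (u 0%N) x.
  exact: partialB.
have dw2 : partial j (w 2) x = partial j (u 2%N) x - partial j (u 0%N) x.
  exact: partialB.
have -> : partial j m x = partial j (u 0%N) x +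
    2^-1 *: partial j (w 1) x + partial j (w 2) x.
  have h1 : differentiable (w 1) x by exact: differentiableB.
  have h2 : differentiable (w 2) x by exact: differentiableB.
  have h3 : differentiable (2^-1 *: w 1) x by exact: differentiableZ.
  have e1 := partialD j (differentiableD d0 h3) h2.
  have e2 := partialD j d0 h3.
  by rewrite e2 (partialZ 2^-1 j h1) in e1.
rewrite dw1 dw2.
move: (partial j (u 0%N) x) (partial j (u 1%N) x) (partial j (u 2%N) x) => a b c.
(* This is the square [|x/2 - y|^2], which enters with the factor [-3/2] after halving and is
   discarded. *)
have := dot_ge0 (2^-1 *: (b - a) - (c - a)).
rewrite !dotE !(dotC b a) !(dotC c a) !(dotC c b); lra.
Qed.

(** The Laplacian part of [H] is pointwise nonnegative by [stage_dissipation]. Adding it to the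
    gradient bound turns the correction into [H], whose integral is zero. *)
Let grad_next_le x : Omega x ->
  2^-1 * grad_sqr next x <= 2^-1 * grad_sqr mn x + H x.
Proof.
move=> Ox.
have -> : grad_sqr next x = grad_sqr (fun x => (enorm (m x))^-1 *: m x) x.
  by apply: eq_bigr => j _; rewrite (eq_on_partial oO j nextE Ox).
have combine (l11 l22 l12 g11 g22 g12 gmn gm gnext : R) :
    0 <= 2^-1 * l11 + 2 * l22 - l12 ->
    2^-1 * gm <= 2^-1 * gmn + (2^-1 * g11 + 2 * g22 - g12) -> gnext <= gm ->
    2^-1 * gnext <= 2^-1 * gmn +
      (2^-1 * (l11 + g11) + 2 * (l22 + g22) + - 1 * (l12 + g12)).
  lra.
have D : 0 <= 2^-1 * dot (laplacian (u 1%N) x) (w 1 x) +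
    2 * dot (laplacian (u 2%N) x) (w 2 x) - dot (laplacian (u 1%N) x) (w 2 x).
  exact: (stage_dissipation stages unit0 Ox alpha_gt0 tau_gt0).
exact: (combine _ _ _ _ _ _ _ _ _ D (grad_update_le Ox)
  (grad_sqr_normalize_le oO mC1 m_ge1 Ox)).
Qed.

Lemma imex_next_energy :
  (dirichlet_energy Omega next <= dirichlet_energy Omega mn)%E.
Proof.
have mni : (lebesgue_rV d).-integrable Omega
    (fun x => (2^-1 * grad_sqr mn x)%:E).
  rewrite grad_sqrE.
  exact: (integrableZl mO 2^-1 (C1_closure_integrable_grad oO bO mnC mnC)).
have [Hi H0] := zH.
have grad_ge0 (f : 'rV[R]_d -> 'rV[R]_3) x : 0 <= 2^-1 * grad_sqr f x.
  by rewrite mulr_ge0 ?invr_ge0// sumr_ge0// => j _; rewrite sqr_ge0.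
(* The vanishing integral of [H] is added to the old energy, so that the pointwise bound can be
   integrated. *)
rewrite /dirichlet_energy -[leRHS]adde0 -H0 -integralD_EFin//.
apply: ge0_le_integral; first exact: mO.
- by move=> x _; rewrite lee_fin.
- apply/measurable_EFinP; apply: measurable_funM; first exact: measurable_cst.
  rewrite grad_sqrE; apply: (C1_measurable_grad oO);
    exact: (eq_on_C1 oO nextE (C1_normalize oO mC1 m_ge1)).
- by apply: (measurable_int (lebesgue_rV d)); exact: integrableD.
- by move=> x Ox; rewrite lee_fin; exact: grad_next_le.
Qed.

End energy.

Unset Implicit Arguments.

Theorem mainTheorem3 (R : realType) :
  A2 *m onev = c2 :> 'cV[R]_2 /\
  second_order (A2 : 'M[R]_2) D2 b2 /\
  forall (d : nat) (Omega : set 'rV[R]_d)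
    (sigma : {finite_measure set 'rV[R]_d -> \bar R})
    (nu : 'rV[R]_d -> 'rV[R]_d) (bc : boundary_condition R d)
    (alpha beta tau : R) (mn : 'rV[R]_d -> 'rV[R]_3)
    (u : nat -> 'rV[R]_d -> 'rV[R]_3),
  regular_domain Omega sigma nu ->
  0 < alpha -> 0 < tau ->
  C1_closure Omega mn ->
  (forall x, Omega x -> enorm (mn x) = 1) ->
  imex_stages alpha beta tau A2 D2 Omega mn u ->
  (forall i, (1 <= i <= 2)%N -> stage_regular Omega (u i)) ->
  (forall i, (i <= 2)%N -> satisfies_bc Omega sigma nu bc (u i)) ->
  (forall x, Omega x -> enorm (imex_next alpha beta tau b2 D2 u x) = 1) /\
  (dirichlet_energy Omega (imex_next alpha beta tau b2 D2 u) <=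
   dirichlet_energy Omega mn)%E.
Proof.
split; first exact: tableau_second_order.1.
split; first exact: tableau_second_order.2.
move=> d Omega sigma nu bc alpha beta tau mn u rO a0 t0 mnC unit0 st reg ubc.
split; first exact: (imex_next_unit unit0 st).
exact: (imex_next_energy rO a0 t0 mnC unit0 st reg ubc).
Qed.
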